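(* Let $F$ be an algebraically closed field of characteristic $p>2$, let $s\geq 1$ be an integer, and put $m=sp+1$. Let $\mathcal{X}$ be the hyperelliptic curve over $F$ given by the affine equation $y^2=x^m+1$. Then: (1) if $s=2k+1$ with $k\geq 0$ an integer, the $a$-number of $\mathcal{X}$ equals $\dfrac{(k+1)(p-1)}{2}$; (2) if $s=2k$ with $k\geq 1$ an integer, the $a$-number of $\mathcal{X}$ equals $\dfrac{k(p-1)}{2}$.
   Context: The curve $\mathcal{X}$ given by an affine equation $y^2=f(x)$, with $f$ a polynomial without multiple roots, means the nonsingular projective curve over $F$ with function field $F(x,y)$, $y^2=f(x)$. The $a$-number $a(\mathcal{X})$ of a nonsingular, projective, irreducible curve $\mathcal{X}$ over $F$ is the $a$-number of its Jacobian $\mathcal{J}_{\mathcal{X}}$, i.e. the dimension over $F$ of $\mathrm{Hom}(\alpha_p,\mathcal{J}_{\mathcal{X}})$, where $\alpha_p$ is the group scheme $\mathrm{Spec}(F[X]/(X^p))$ with co-multiplication $X\mapsto 1\otimes X+X\otimes 1$. Equivalently, $a(\mathcal{X})$ is the dimension of the $F$-vector space of exact holomorphic differentials on $\mathcal{X}$, i.e. the dimension of the kernel of the Cartier operator $\mathscr{C}$ on $H^0(\mathcal{X},\Omega^1)$. Here, for a separating variable $x$ of the function field $K$ of $\mathcal{X}$, every differential can be written $\omega=(f_0^p+f_1^px+\cdots+f_{p-1}^px^{p-1})dx$ with $f_i\in K$, and $\mathscr{C}(\omega)=f_{p-1}dx$ (independent of the choice of $x$). *)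

(* Defs.v *)
From HB Require Import structures.
From mathcomp Require Import all_boot all_order all_algebra all_field.

Set Implicit Arguments.
Unset Strict Implicit.
Unset Printing Implicit Defensive.

Import GRing.Theory.
Local Open Scope ring_scope.

(* Function fields of one variable over F are taken as finite extensions K    *)
(* of F(x) = {fraction {poly F}}; a nonsingular projective curve is given by  *)
(* its function field, and its points are the places of K over F.             *)

Section FunctionField.

Variables (F : fieldType) (K : fieldExtType {fraction {poly F}}).

Definition of_poly (g : {poly F}) : K := (tofrac g)%:A.

Definition cst (c : F) : K := of_poly c%:P.

Definition xvar : K := of_poly 'X.

(* K = F(x, y) with y^2 = f(x). *)
Definition is_double_cover (f : {poly F}) (y : K) : Prop :=
  y ^+ 2 = of_poly f /\ <<1%VS; y>>%VS = fullv.

(* Valuation rings of K over F, i.e. the local rings of the curve. *)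
Definition is_place (O : {pred K}) : Prop :=
  [/\ subring_closed O,
      forall c : F, cst c \in O,
      exists z : K, z \notin O
    & forall z : K, z \in O \/ z^-1 \in O].

Definition is_derivation (M : lmodType K) (D : K -> M) : Prop :=
  [/\ forall u v, D (u + v) = D u + D v,
      forall u v, D (u * v) = u *: D v + v *: D u
    & forall c : F, D (cst c) = 0].

(* (Omega, d) is the module of Kaehler differentials of K over F. *)
Definition is_Kaehler (Omega : lmodType K) (d : K -> Omega) : Prop :=
  is_derivation d /\
  forall (M : lmodType K) (D : K -> M), is_derivation D ->
    exists2 phi : {linear Omega -> M},
      forall u, phi (d u) = D u
    & forall psi : {linear Omega -> M}, (forall u, psi (d u) = D u) ->
        psi =1 phi.

Variables (Omega : lmodType K) (d : K -> Omega).

(* w lies in the stalk at O of the sheaf of differentials of the curve, which *)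
(* is the O-submodule of Omega generated by the du, u in O.                   *)
Definition regular_at (O : {pred K}) (w : Omega) : Prop :=
  exists (n : nat) (h u : 'I_n -> K),
    (forall i, h i \in O /\ u i \in O) /\ w = \sum_(i < n) h i *: d (u i).

Definition holomorphic (w : Omega) : Prop :=
  forall O : {pred K}, is_place O -> regular_at O w.

(* The graph of the Cartier operator, computed with the variable x; this      *)
(* presupposes that K has characteristic p and is separable over F(x).        *)
Definition cartier (p : nat) (w w' : Omega) : Prop :=
  exists f : nat -> K,
    w = (\sum_(i < p) f i ^+ p * xvar ^+ i) *: d xvar /\
    w' = f p.-1 *: d xvar.

(* V is an F-subspace of Omega of dimension n. *)
Definition has_dim (V : Omega -> Prop) (n : nat) : Prop :=
  exists b : 'I_n -> Omega,
    (forall w, V w <-> exists c : 'I_n -> F, w = \sum_(i < n) cst (c i) *: b i)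
    /\ (forall c : 'I_n -> F,
          \sum_(i < n) cst (c i) *: b i = 0 -> forall i, c i = 0).

Definition has_a_number (p n : nat) : Prop :=
  has_dim (fun w => holomorphic w /\ cartier p w 0) n.

End FunctionField.

(* Main.v *)
Require Import Defs.
From HB Require Import structures.
From mathcomp Require Import all_boot all_order all_algebra all_field.
From mathcomp Require Import boolp ring zify.

Set Implicit Arguments.
Unset Strict Implicit.
Unset Printing Implicit Defensive.

Import GRing.Theory.
Local Open Scope ring_scope.

(** Write p = 2n + 1 and let g be the genus, so that m is 2g + 1 or 2g + 2. The
    proof determines the holomorphic differentials of y^2 = x^m + 1 and then
    the kernel of the Cartier operator on them.

    Holomorphic differentials. The universal property makes the differentials
    of K a line spanned by dx (Kaehler_line), because the derivation d/dx of
    K exists (derivation_ex). On an affine model Y^2 = f(X) with f separable,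
    the form dX/Y generates the regular differentials: it is a combination of
    dX and dY since f and f' are coprime (ordinate_diff), and conversely the
    local ring at a point consists of fractions of F[X, Y], whose
    differentials lie in that local ring times dX/Y (der_local_ring). These
    local rings are valuation rings (local_ring_valuation), hence places, and
    an element of all of them lies in F[X, Y] (integral_of_local). So the
    differentials regular over the affine model are F[X, Y] dX/Y. This is used
    for the model (x, y) and for the model at infinity t = 1/x,
    y' = y/x^(g+1) (infinity_chart); every place contains x or t. Since
    dx/y = - t^(g-1) dt/y', being regular at infinity as well leaves exactly
    the forms a(x) dx/y with deg a < g (holomorphic_cover).

    Cartier operator. With f = x^m + 1 one has a/y = y^(-p) a f^n, so a dx/y is
    killed if and only if a f^n has no monomial of exponent = -1 mod p: if z dx
    is killed then (d/dx)^(p-1) z = 0, and this derivative detects precisely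
    these monomials (cartier_free_poly). As m = 1 mod p, the exponents in
    x^i f^n are i + jm, of residue i + j, for j = 0, ..., n; as i < m, they are
    distinct for distinct pairs (i, j), so nothing cancels. Hence the condition
    is that a_i = 0 whenever the residue of i modulo p is at least n
    (coef_cartier), and the a-number is the number of i < g with residue less
    than n. *)

(** * The coordinate ring of an affine hyperelliptic curve *)

Section CoordinateRing.

Variables (F : fieldType) (f : {poly F}).
Implicit Types u v : {poly F} * {poly F}.

(** The pair [u] stands for u.1 + u.2 Y in F[X, Y]/(Y^2 - f). Evaluation at
    [e : {poly F} -> R] and a square root of [e f] covers both the inclusion
    into the function field and the value at a point of the curve. *)
Definition ev (R : comNzRingType) (e : {rmorphism {poly F} -> R}) (Y : R) u :=
  e u.1 + e u.2 * Y.

Definition cmul u v : {poly F} * {poly F} :=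
  (u.1 * v.1 + u.2 * v.2 * f, u.1 * v.2 + u.2 * v.1).

Definition cnorm u : {poly F} := u.1 ^+ 2 - u.2 ^+ 2 * f.

Section Evaluation.

Variables (R : comNzRingType) (e : {rmorphism {poly F} -> R}) (Y : R).
Hypothesis hY : Y ^+ 2 = e f.

Lemma evD u v : ev e Y (u + v) = ev e Y u + ev e Y v.
Proof. by rewrite /ev !rmorphD /=; ring. Qed.

Lemma evB u v : ev e Y (u - v) = ev e Y u - ev e Y v.
Proof. by rewrite /ev !rmorphB /=; ring. Qed.

Lemma evM u v : ev e Y (cmul u v) = ev e Y u * ev e Y v.
Proof. by rewrite /ev /cmul !rmorphD !rmorphM /=; ring: hY. Qed.

Lemma ev_poly a : ev e Y (a, 0) = e a.
Proof. by rewrite /ev /= rmorph0 mul0r addr0. Qed.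

Lemma ev_conj u : ev e Y u * ev e Y (u.1, - u.2) = e (cnorm u).
Proof. by rewrite /ev /cnorm /=; ring: hY. Qed.

End Evaluation.

End CoordinateRing.

(** * Local rings of the affine curve *)

(** The data of an affine model Y^2 = f(X) of the function field K, where X is
    the image of ['X] under [e]. *)
Definition is_chart (F K : fieldType) (f : {poly F})
    (e : {rmorphism {poly F} -> K}) (Y : K) : Prop :=
  [/\ separable_poly f, Y ^+ 2 = e f, forall u, ev e Y u = 0 -> u = 0
    & forall z, exists u v, ev e Y v != 0 /\ z * ev e Y v = ev e Y u].

Section LocalRings.

Variables (F K : fieldType) (f : {poly F}).
Variables (e : {rmorphism {poly F} -> K}) (Y : K).
Hypothesis chart : is_chart f e Y.
Hypothesis two_neq0 : 2%:R != 0 :> F.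

Let f_sep : separable_poly f. Proof. by case: chart. Qed.
Let hY : Y ^+ 2 = e f. Proof. by case: chart. Qed.

Lemma chart_frac z : exists u v, ev e Y v != 0 /\ z * ev e Y v = ev e Y u.
Proof. by case: chart => _ _ _; apply. Qed.

Lemma ev_eq0 u : ev e Y u = 0 -> u = 0.
Proof. by case: chart => _ _ h _; exact: h. Qed.

Lemma ev_inj : injective (ev e Y).
Proof.
by move=> u v uv; apply/eqP; rewrite -subr_eq0; apply/eqP/ev_eq0;
  rewrite evB uv subrr.
Qed.

Lemma chart_poly_eq0 a : e a = 0 -> a = 0.
Proof. by rewrite -(ev_poly e Y) => /ev_eq0 []. Qed.

Lemma cnorm_neq0 u : u != 0 -> cnorm f u != 0.
Proof.
apply: contra_neq => N0; have := ev_conj hY u; rewrite N0 rmorph0.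
move=> /eqP; rewrite mulf_eq0 => /orP [] /eqP /ev_eq0 // [].
by case: u {N0} => a b /= -> /eqP; rewrite oppr_eq0 => /eqP ->.
Qed.

Section Point.

Variables (al be : F).
Hypothesis on_curve : be ^+ 2 = f.[al].

Local Notation at_P := (ev (horner_eval al) be).

Let hP : be ^+ 2 = horner_eval al f. Proof. exact: on_curve. Qed.

Definition local_ring : {pred K} := fun z =>
  `[< exists u v, at_P v != 0 /\ z * ev e Y v = ev e Y u >].

Lemma local_ringP z :
  reflect (exists u v, at_P v != 0 /\ z * ev e Y v = ev e Y u)
    (z \in local_ring).
Proof. exact: asboolP. Qed.

Lemma at_PE u : at_P u = u.1.[al] + u.2.[al] * be.
Proof. by []. Qed.

Lemma at_P_neq0 u : at_P u != 0 -> ev e Y u != 0.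
Proof.
by apply: contra_neq => /ev_eq0 ->; rewrite /ev /= !rmorph0 mul0r addr0.
Qed.

Lemma ev_local u : ev e Y u \in local_ring.
Proof.
apply/local_ringP; exists u, (1, 0); rewrite !ev_poly !rmorph1 mulr1.
by rewrite oner_eq0.
Qed.

Lemma local_div x v : x \in local_ring -> at_P v != 0 ->
  x / ev e Y v \in local_ring.
Proof.
move=> /local_ringP [a [b [b0 xb]]] v0; apply/local_ringP.
exists a, (cmul f b v); rewrite !evM // mulf_neq0 // -xb; split=> //.
have := at_P_neq0 v0 => v1.
by field.
Qed.

Lemma local_ring_subring : subring_closed local_ring.
Proof.
split=> [|x z|x z].
- by rewrite -[1](rmorph1 e) -(ev_poly e Y); exact: ev_local.
- move=> /local_ringP [a [b [b0 xb]]] /local_ringP [a' [b' [b0' zb]]].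
  apply/local_ringP; exists (cmul f a b' - cmul f a' b), (cmul f b b').
  by rewrite evB !evM // mulf_neq0 // -xb -zb; split=> //; ring.
- move=> /local_ringP [a [b [b0 xb]]] /local_ringP [a' [b' [b0' zb]]].
  apply/local_ringP; exists (cmul f a a'), (cmul f b b').
  by rewrite !evM // mulf_neq0 // -xb -zb; split=> //; ring.
Qed.

Lemma local_ringD x z : x \in local_ring -> z \in local_ring ->
  x + z \in local_ring.
Proof.
case: local_ring_subring => O1 OB _ Ox Oz.
by rewrite -[z]opprK -[- z]sub0r -(subrr 1) !OB.
Qed.

Lemma local_ringM x z : x \in local_ring -> z \in local_ring ->
  x * z \in local_ring.
Proof. by case: local_ring_subring => _ _; apply. Qed.

Lemma sep_root_neq0 g : f = g * ('X - al%:P) -> g.[al] != 0.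
Proof.
by move=> fg; move: f_sep; rewrite fg separable_root => /andP [].
Qed.

Lemma root_factor (g : {poly F}) : g.[al] = 0 ->
  exists h, g = h * ('X - al%:P).
Proof. by move=> /eqP /factor_theorem. Qed.

Let norm_order k u := exists2 M : {poly F},
  M.[al] != 0 & cnorm f u = M * ('X - al%:P) ^+ k.

Lemma cnorm_root M u : cnorm f u = M * ('X - al%:P) ^+ 0 -> at_P u == 0 ->
  M.[al] == 0.
Proof.
move=> NM /eqP uP; have := ev_conj hP u.
by rewrite uP mul0r NM expr0 mulr1 => /esym /eqP.
Qed.

Lemma norm_order_exists u : u != 0 -> exists k, norm_order k u.
Proof.
move=> u0; have N0 := cnorm_neq0 u0.
have [k [M hM Nk]] := multiplicity_XsubC (cnorm f u) al.
by exists k, M => //; move: hM; rewrite N0.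
Qed.

Let order_of pi u := exists n v1 v2,
  [/\ at_P v1 != 0, at_P v2 != 0 & ev e Y u * ev e Y v1 = ev e Y v2 * pi ^+ n].

Lemma order_unit pi u : at_P u != 0 -> order_of pi u.
Proof.
move=> u0; exists 0%N, (1, 0), u; split=> //.
  by rewrite ev_poly rmorph1 oner_eq0.
by rewrite ev_poly rmorph1 expr0.
Qed.

Lemma order_step pi u u' w : at_P w != 0 ->
  ev e Y u * ev e Y w = ev e Y u' * pi -> order_of pi u' -> order_of pi u.
Proof.
move=> w0 huw [n [v1 [v2 [h1 h2 h3]]]].
exists n.+1, (cmul f w v1), v2; rewrite !evM // mulf_neq0 //; split=> //.
by rewrite mulrA huw exprS mulrAC h3; ring.
Qed.

(** Away from the branch points X - al is a uniformizer. If u vanishes at the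
    point and is not divisible by X - al, its conjugate does not vanish there,
    and u is N(u) divided by that conjugate; dividing u by X - al lowers the
    order of N(u) by 2. *)
Lemma order_unramified u : be != 0 -> u != 0 ->
  order_of (e ('X - al%:P)) u.
Proof.
move=> be0 u0; have [k] := norm_order_exists u0.
elim/ltn_ind: k u u0 => k IHk u u0 [M M0 NM].
have [|uP] := boolP (at_P u == 0); last exact: order_unit.
rewrite at_PE => /eqP uP.
have two_be : 2%:R * be != 0 by rewrite mulf_neq0.
have [u1|u1] := eqVneq u.1.[al] 0.
- (* both coordinates are divisible by X - al *)
  have /root_factor [b ub] : u.2.[al] = 0.
    by apply: (mulIf be0); rewrite mul0r -[RHS]uP u1 add0r.
  have [a ua] := root_factor u1.
  have Nu' : cnorm f u = cnorm f (a, b) * ('X - al%:P) ^+ 2.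
    by rewrite /cnorm ua ub /=; ring.
  have u'0 : (a, b) != 0.
    apply: contra_neq u0 => -[a0 b0].
    by move: ua ub; rewrite a0 b0 !mul0r; case: (u) => ? ? /= -> ->.
  case: k IHk NM => [|[|k]] IHk NM.
  + by rewrite (cnorm_root NM) // in M0; rewrite at_PE uP.
  + have X0 : 'X - al%:P != 0 :> {poly F} by rewrite polyXsubC_eq0.
    have := congr1 (fun q => q %/ ('X - al%:P)) NM.
    rewrite Nu' expr1 mulpK // expr2 mulrA mulpK // => h; move: M0.
    by rewrite -h !hornerE subrr mulr0 eqxx.
  apply: (@order_step _ _ (a, b) (1, 0)); rewrite ?ev_poly ?rmorph1 ?oner_eq0 //.
    by rewrite /ev ua ub /= !rmorphM; ring.
  apply: (IHk k) => //; exists M => //.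
  apply: (mulIf (_ : ('X - al%:P) ^+ 2 != 0)).
    by rewrite expf_neq0 // polyXsubC_eq0.
  by rewrite -Nu' NM -addn2 exprD mulrA.
- (* the conjugate of u is a unit at P *)
  exists k, (u.1, - u.2), (M, 0); split.
  + rewrite at_PE hornerN.
    have -> : u.1.[al] + - u.2.[al] * be =
      2%:R * u.1.[al] - (u.1.[al] + u.2.[al] * be) by ring.
    by rewrite uP subr0 mulf_neq0.
  + by rewrite ev_poly.
  + by rewrite (ev_conj hY) ev_poly NM !rmorphM rmorphXn.
Qed.

(** At a branch point Y is a uniformizer; dividing by Y lowers the order of the
    norm by 1. *)
Lemma order_ramified u : be = 0 -> u != 0 -> order_of Y u.
Proof.
move=> be0 u0; have [g fg] : exists g, f = g * ('X - al%:P).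
  by apply: root_factor; rewrite -on_curve be0 expr0n.
have g0 := sep_root_neq0 fg.
have [k] := norm_order_exists u0.
elim: k u u0 => [|k IHk] u u0 [M M0 NM].
all: have [|uP] := boolP (at_P u == 0); last exact: order_unit.
all: move=> /[dup] uP; rewrite at_PE be0 mulr0 addr0 => /eqP /root_factor [a ua].
- by rewrite (cnorm_root NM) in M0.
(* Y^2 = g (X - al), so that u g = Y (u.2 g + a Y) *)
apply: (@order_step _ _ (u.2 * g, a) (g, 0)).
- by rewrite ev_poly.
- rewrite ev_poly /ev ua /= !rmorphM.
  have -> : (e (u.2) * e g + e a * Y) * Y = e u.2 * e g * Y + e a * Y ^+ 2.
    by ring.
  by rewrite hY [in RHS]fg rmorphM; ring.
apply: IHk.
  apply: contra_neq u0 => -[/eqP]; rewrite mulf_eq0 => /orP [/eqP u20|/eqP g1].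
    by move=> a0; move: ua u20; rewrite a0 mul0r; case: (u) => ? ? /= -> ->.
  by move: g0; rewrite g1 horner0 eqxx.
exists (- g * M); first by rewrite hornerM hornerN mulf_neq0 // oppr_eq0.
have X0 : 'X - al%:P != 0 :> {poly F} by rewrite polyXsubC_eq0.
apply: (mulIf X0); rewrite -mulrA -mulrA -exprSr -NM /cnorm ua /= fg.
by ring.
Qed.

(** If every nonzero element of the coordinate ring is a unit times a power of
    pi, then comparing the two exponents in a fraction u / v decides which of
    u / v and v / u lies in the local ring. *)
Lemma chart_frac_order pi z :
  pi != 0 -> (forall u, u != 0 -> order_of pi u) -> pi \in local_ring ->
  z \in local_ring \/ z^-1 \in local_ring.
Proof.
move=> pi0 ord_pi piO.
have [->|z0] := eqVneq z 0.
  by left; rewrite -(rmorph0 e) -(ev_poly e Y) ev_local.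
have piX n : pi ^+ n \in local_ring.
  elim: n => [|n IHn]; last by rewrite exprS local_ringM.
  by rewrite expr0 -[1](rmorph1 e) -(ev_poly e Y) ev_local.
have quot a b a1 a2 b1 b2 n k w : (k <= n)%N ->
    at_P a1 != 0 -> at_P b2 != 0 ->
    ev e Y a * ev e Y a1 = ev e Y a2 * pi ^+ n ->
    ev e Y b * ev e Y b1 = ev e Y b2 * pi ^+ k ->
    ev e Y b != 0 -> w * ev e Y b = ev e Y a -> w \in local_ring.
  move=> kn /[dup] a10 /at_P_neq0 a1K /[dup] b20 /at_P_neq0 b2K ha hb b0 wb.
  have b1K : ev e Y b1 != 0.
    apply/eqP => b10; move/eqP: hb; rewrite b10 mulr0 eq_sym mulf_eq0.
    by rewrite (negPf b2K) expf_eq0 (negPf pi0) andbF.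
  have -> : w = ev e Y a2 * ev e Y b1 * pi ^+ (n - k) / ev e Y b2 / ev e Y a1.
    apply: (mulIf a1K); apply: (mulIf b2K); rewrite !divfK //.
    apply: (mulIf (_ : pi ^+ k != 0)); first by rewrite expf_neq0.
    have -> : w * ev e Y a1 * ev e Y b2 * pi ^+ k =
       w * ev e Y b * ev e Y a1 * ev e Y b1.
      by rewrite -mulrA -hb; ring.
    by rewrite wb ha -(subnK kn) exprD addnK; ring.
  do 2 apply: local_div => //.
  by apply: local_ringM => //; apply: local_ringM; exact: ev_local.
have [u [v [v0 zv]]] := chart_frac z.
have u0 : ev e Y u != 0 by rewrite -zv mulf_neq0.
have nz w : ev e Y w != 0 -> w != 0.
  by apply: contra_neq => ->; rewrite /ev !rmorph0 mul0r addr0.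
have [n [u1 [u2 [hu1 hu2 hu]]]] := ord_pi _ (nz _ u0).
have [k [v1 [v2 [hv1 hv2 hv]]]] := ord_pi _ (nz _ v0).
case: (leqP k n) => [kn|/ltnW nk].
  by left; apply: (quot u v u1 u2 v1 v2 n k).
right; apply: (quot v u v1 v2 u1 u2 k n) => //.
by rewrite -zv mulKf.
Qed.

Lemma local_ring_proper : exists z, z \notin local_ring.
Proof.
have X0 : e ('X - al%:P) != 0.
  by apply/eqP => /chart_poly_eq0 /eqP; rewrite polyXsubC_eq0.
exists (e ('X - al%:P))^-1; apply/negP => /local_ringP [u [v [v0 h]]].
move: v0; have -> : v = cmul f ('X - al%:P, 0) u.
  by apply: ev_inj; rewrite evM // ev_poly -h mulVKf.
rewrite evM // at_PE /= hornerXsubC subrr horner0 !mul0r addr0.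
by rewrite mul0r eqxx.
Qed.

Lemma local_ring_valuation z : z \in local_ring \/ z^-1 \in local_ring.
Proof.
have [be0|be0] := eqVneq be 0.
- apply: (chart_frac_order (pi := Y)).
  + apply/eqP => Y0; have /eqP := hY.
    rewrite Y0 expr0n /= eq_sym => /eqP /chart_poly_eq0 f0.
    by move: f_sep => /separable_poly_neq0; rewrite f0 eqxx.
  + by move=> u; exact: order_ramified.
  + have -> : Y = ev e Y (0, 1).
      by rewrite /ev rmorph0 rmorph1 add0r mul1r.
    exact: ev_local.
- apply: (chart_frac_order (pi := e ('X - al%:P))).
  + by apply/eqP => /chart_poly_eq0 /eqP; rewrite polyXsubC_eq0.
  + by move=> u; exact: order_unramified.
  + by rewrite -(ev_poly e Y) ev_local.
Qed.

End Point.
End LocalRings.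

(** * Functions that are integral on the affine curve *)

Lemma nth_root_exists (F : closedFieldType) n (c : F) :
  (0 < n)%N -> exists b, b ^+ n = c.
Proof.
move=> n_gt0; have /closed_rootP [b] : size ('X^n - c%:P) != 1%N.
  by rewrite size_XnsubC // eqSS gtn_eqF.
by rewrite /root !hornerE subr_eq0 => /eqP; exists b.
Qed.

Section Integrality.

Variables (F : closedFieldType) (K : fieldType) (f : {poly F}).
Variables (e : {rmorphism {poly F} -> K}) (Y : K).
Hypothesis chart : is_chart f e Y.
Hypothesis two_neq0 : 2%:R != 0 :> F.

Let hY : Y ^+ 2 = e f. Proof. by case: chart. Qed.

Lemma ev_vanish u w t al be : be ^+ 2 = f.[al] ->
  t \in local_ring e Y al be -> ev e Y u = t * ev e Y w ->
  ev (horner_eval al) be w = 0 -> ev (horner_eval al) be u = 0.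
Proof.
move=> hP /local_ringP [a [b [b0 tb]]] utw w0.
have : cmul f u b = cmul f a w.
  by apply: (ev_inj chart); rewrite !evM // utw -tb; ring.
move=> /(congr1 (ev (horner_eval al) be)).
by rewrite !evM // w0 mulr0 => /eqP; rewrite mulf_eq0 (negPf b0) orbF => /eqP.
Qed.

(** Write z = u / c with c in F[X] of least degree. A root al of c gives one or
    two points of the curve, and z being regular there forces both coordinates
    of u to vanish at al, so that X - al can be cancelled. *)
Lemma integral_of_local z :
  (forall al be, be ^+ 2 = f.[al] -> z \in local_ring e Y al be) ->
  exists u, z = ev e Y u.
Proof.
move=> z_loc.
have [c [u [c0 zc]]] : exists c u, c != 0 /\ z * e c = ev e Y u.
  have [u [v [v0 zv]]] := chart_frac chart z.
  exists (cnorm f v), (cmul f u (v.1, - v.2)); split; last first.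
    by rewrite evM // -zv -mulrA (ev_conj hY).
  apply: (cnorm_neq0 chart); apply: contra_neq v0 => ->.
  by rewrite /ev !rmorph0 mul0r addr0.
elim: {c}(size c) {-2}c (erefl (size c)) u c0 zc => [|n IHn] c size_c u c0 zc.
  by move/eqP: size_c; rewrite size_poly_eq0 (negPf c0).
have [c1|c1] := eqVneq (size c) 1%N.
  have /size_poly1P [k k0 ck] : size c == 1%N by rewrite c1.
  exists (cmul f (k^-1%:P, 0) u); rewrite evM // -zc ev_poly ck.
  by rewrite mulrCA -rmorphM -polyCM mulVf // rmorph1 mulr1.
have /closed_rootP [al /factor_theorem [c' cc']] := c1.
have X0 : e ('X - al%:P) != 0.
  by apply/eqP => /(chart_poly_eq0 chart) /eqP; rewrite polyXsubC_eq0.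
have c'0 : c' != 0 by apply: contra_neq c0 => c'0; rewrite cc' c'0 mul0r.
have size_c' : size c' = n.
  by move: size_c; rewrite cc' size_Mmonic ?monicXsubC // size_XsubC addn2 => -[].
have zc' : z * e c' = ev e Y u / e ('X - al%:P).
  by apply: (mulIf X0); rewrite divfK // -zc cc' rmorphM mulrA.
have [be hP] := nth_root_exists f.[al] (isT : (0 < 2)%N).
have zc'_loc b : b ^+ 2 = f.[al] ->
    ev e Y u / e ('X - al%:P) \in local_ring e Y al b.
  move=> hb; rewrite -zc'; apply: (local_ringM chart hb); first exact: z_loc.
  by rewrite -(ev_poly e Y); exact: ev_local.
have uP b : b ^+ 2 = f.[al] -> u.1.[al] + u.2.[al] * b = 0.
  move=> hb; rewrite -at_PE.
  apply: (ev_vanish hb (zc'_loc b hb) (w := ('X - al%:P, 0))).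
    by rewrite ev_poly divfK.
  by rewrite at_PE /= hornerXsubC subrr horner0 mul0r addr0.
have [u1 u2] : u.1.[al] = 0 /\ u.2.[al] = 0.
  have [be0|be0] := eqVneq be 0.
    have u10 : u.1.[al] = 0 by rewrite -[RHS](uP be) // be0 mulr0 addr0.
    split=> //.
    have [g fg] : exists g, f = g * ('X - al%:P).
      by apply: root_factor; rewrite -hP be0 expr0n.
    have g0 := sep_root_neq0 chart fg.
    have [a ua] := root_factor u10.
    (* the only point above al gives u.1.[al] = 0; apply the same argument to
       Y u / (X - al), whose value there is u.2.[al] g.[al] *)
    have : ev (horner_eval al) be (u.2 * g, a) = 0.
      apply: (ev_vanish hP (zc'_loc be hP) (w := (0, 1))); last first.
        by rewrite at_PE /= be0 mulr0 addr0 horner0.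
      apply: (mulIf X0); rewrite mulrAC divfK // /ev ua /=.
      have -> : (e (u.2 * g) + e a * Y) * e ('X - al%:P) =
         e u.2 * e (g * ('X - al%:P)) + e a * e ('X - al%:P) * Y.
        by rewrite !rmorphM; ring.
      by rewrite -fg -hY !rmorphM rmorph0 rmorph1; ring.
    rewrite at_PE /= be0 mulr0 addr0 hornerM => /eqP.
    by rewrite mulf_eq0 (negPf g0) orbF => /eqP.
  have hN : (- be) ^+ 2 = f.[al] by rewrite sqrrN.
  have h1 := uP _ hP; have h2 := uP _ hN.
  have : 2%:R * u.1.[al] = 0.
    by rewrite -[RHS]addr0 -{1}h1 -h2; ring.
  move=> /eqP; rewrite mulf_eq0 (negPf two_neq0) /= => /eqP u1; split=> //.
  by apply: (mulIf be0); rewrite mul0r -[RHS]h1 u1 add0r.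
have [a ua] := root_factor u1; have [b ub] := root_factor u2.
apply: (IHn c' size_c' (a, b) c'0).
rewrite zc'; apply: (mulIf X0); rewrite divfK // /ev ua ub /=.
by rewrite !rmorphM; ring.
Qed.

End Integrality.

(** * Derivations of the function field *)

Section Derivations.

Variables (F K : fieldType) (f : {poly F}) (e : {rmorphism {poly F} -> K}).
Variable Y : K.
Hypothesis chart : is_chart f e Y.
Hypothesis two_neq0 : 2%:R != 0 :> F.
Variables (M : lmodType K) (d : K -> M).
Hypothesis dD : forall u v, d (u + v) = d u + d v.
Hypothesis dM : forall u v, d (u * v) = u *: d v + v *: d u.
Hypothesis dC : forall c, d (e c%:P) = 0.

Let hY : Y ^+ 2 = e f. Proof. by case: chart. Qed.

Lemma der0 : d 0 = 0.
Proof. by rewrite -(rmorph0 e) -polyC0 dC. Qed.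

Lemma der_poly a : d (e a) = e a^`() *: d (e 'X).
Proof.
elim/poly_ind: a => [|a c IHa].
  by rewrite deriv0 !rmorph0 der0 scale0r.
rewrite rmorphD dD dC addr0 rmorphM dM IHa derivD derivC addr0 derivM
  derivX mulr1.
by rewrite rmorphD !rmorphM scalerDl !scalerA addrC [e 'X * _]mulrC.
Qed.

Lemma der_ordinate : (2%:R * Y) *: d Y = e f^`() *: d (e 'X).
Proof.
by rewrite -der_poly -hY expr2 dM -scalerDl mulr_natl mulr2n.
Qed.

Lemma ordinate_neq0 : Y != 0.
Proof.
apply/eqP => Y0; have /eqP := hY; rewrite Y0 expr0n /= eq_sym.
move=> /eqP /(chart_poly_eq0 chart) f0; case: chart => /separable_poly_neq0.
by rewrite f0 eqxx.
Qed.

(** Since 2 Y dY = f'(X) dX, the element Y du/dX stays in F[X, Y]; this is its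
    coordinate pair. *)
Definition cder (u : {poly F} * {poly F}) : {poly F} * {poly F} :=
  (u.2^`() * f + 2%:R^-1 *: (u.2 * f^`()), u.1^`()).

Lemma der_ev u : Y *: d (ev e Y u) = ev e Y (cder u) *: d (e 'X).
Proof.
rewrite /ev dD dM (der_poly u.1) (der_poly u.2) /cder /= !scalerDr !scalerA.
have half : e (2%:R^-1)%:P * 2%:R = 1.
  by rewrite -(rmorph_nat e 2) -polyC_natr -rmorphM -polyCM mulVf // rmorph1.
have -> : Y * e u.2 = e (2%:R^-1 *: u.2) * (2%:R * Y).
  transitivity (e u.2 * Y * (e (2%:R^-1)%:P * 2%:R)).
    by rewrite half; ring.
  by rewrite -mul_polyC rmorphM; ring.
rewrite -[(e _ * (2%:R * Y)) *: _]scalerA der_ordinate scalerA -!scalerDl.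
congr (_ *: _).
by rewrite -!mul_polyC !rmorphD !rmorphM -hY; ring.
Qed.

Lemma der_frac z u v : z * ev e Y v = ev e Y u ->
  (Y * ev e Y v) *: d z = (ev e Y (cder u) - z * ev e Y (cder v)) *: d (e 'X).
Proof.
move=> zv; rewrite scalerBl -(der_ev u) -zv dM scalerDr.
rewrite -[(z * ev e Y (cder v)) *: _]scalerA -(der_ev v) !scalerA.
by rewrite [z * Y]mulrC addrAC subrr add0r.
Qed.

(** By the quotient rule Y dz/dX has the square of a denominator of z as
    denominator. *)
Lemma der_local_ring al be z : be ^+ 2 = f.[al] ->
  z \in local_ring e Y al be ->
  exists2 l, l \in local_ring e Y al be & Y *: d z = l *: d (e 'X).
Proof.
move=> hP zO; have /local_ringP [u [v [v0 zv]]] := zO.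
have vK := at_P_neq0 chart v0.
exists ((ev e Y (cder u) - z * ev e Y (cder v)) / ev e Y v).
  apply: (local_div chart hP) => //.
  have [_ OB OM] := local_ring_subring chart hP.
  by rewrite OB ?OM ?ev_local.
rewrite mulrC -scalerA -(der_frac zv) scalerA; congr (_ *: _).
by rewrite mulrCA mulVf ?mulr1.
Qed.

(** By der_local_ring each term h du is an element of the local ring times
    dX / Y, hence so is the sum. *)
Lemma regular_in_local_ring al be z n (h u : 'I_n -> K) : d (e 'X) != 0 ->
  be ^+ 2 = f.[al] ->
  (forall i, h i \in local_ring e Y al be /\ u i \in local_ring e Y al be) ->
  z *: d (e 'X) = \sum_(i < n) h i *: d (u i) ->
  z * Y \in local_ring e Y al be.
Proof.
move=> dX0 hP hu zE.
have [_ OB OM] := local_ring_subring chart hP.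
have O0 : 0 \in local_ring e Y al be.
  by have := ev_local e Y al be 0; rewrite /ev !rmorph0 mul0r addr0.
have [l lO hl] : exists2 l, l \in local_ring e Y al be &
    Y *: \sum_(i < n) h i *: d (u i) = l *: d (e 'X).
  elim/big_ind: _ => [|w w' [l lO hl] [l' lO' hl']|i _].
  - by exists 0; rewrite // scaler0 scale0r.
  - exists (l + l'); first exact: (local_ringD chart hP).
    by rewrite scalerDr hl hl' scalerDl.
  - have [l lO hl] := der_local_ring hP (hu i).2.
    exists (h i * l); first by apply: OM; first exact: (hu i).1.
    by rewrite scalerA [Y * _]mulrC -[(h i * Y) *: _]scalerA hl scalerA.
suff -> : z * Y = l by [].
apply/eqP; rewrite -subr_eq0; move/eqP: hl.
rewrite -zE scalerA -subr_eq0 -scalerBl scaler_eq0 (negPf dX0) orbF.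
by rewrite mulrC.
Qed.

(** f and f' are coprime, so that dX / Y is a combination of Y dX and dY. *)
Lemma ordinate_diff : exists r : {poly F} * {poly F},
  d (e 'X) = Y *: ((e r.1 * Y) *: d (e 'X) + (e r.2 * 2%:R) *: d Y).
Proof.
have [r hr] : exists r : {poly F} * {poly F}, r.1 * f + r.2 * f^`() = 1.
  apply/Bezout_eq1_coprimepP.
  by case: chart; rewrite separable_poly.unlock.
exists r; rewrite scalerDr !scalerA.
have -> : Y * (e r.2 * 2%:R) = e r.2 * (2%:R * Y) by ring.
rewrite -[(e r.2 * _) *: _]scalerA der_ordinate scalerA -scalerDl.
have -> : Y * (e r.1 * Y) + e r.2 * e f^`() = 1.
  by rewrite -(rmorph1 e) -hr rmorphD !rmorphM -hY; ring.
by rewrite scale1r.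
Qed.

End Derivations.

Section DerivationExists.

Variables (F K : fieldType) (f : {poly F}) (e : {rmorphism {poly F} -> K}).
Variable Y : K.
Hypothesis chart : is_chart f e Y.
Hypothesis two_neq0 : 2%:R != 0 :> F.

Let hY : Y ^+ 2 = e f. Proof. by case: chart. Qed.

Lemma cderD u v : cder f (u + v) = cder f u + cder f v.
Proof.
rewrite /cder /=; congr (_, _); last by rewrite derivD.
by rewrite derivD !mulrDl scalerDr addrACA.
Qed.

Lemma cderM u v :
  cder f (cmul f u v) = cmul f u (cder f v) + cmul f v (cder f u).
Proof.
set c := (2%:R^-1)%:P : {poly F}.
have half : f^`() = 2%:R * (c * f^`()).
  by rewrite mulrA -polyC_natr -polyCM divff // mul1r.
rewrite /cder /cmul /= -!mul_polyC -/c !derivE ![c * (_ * f^`())]mulrCA.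
move: (c * f^`()) half => g half.
by congr (_, _); rewrite /= ?half; ring.
Qed.

(** What w = dz/dX has to satisfy for every way of writing z as a fraction. *)
Definition quotient_rule z w := forall u v, ev e Y v != 0 ->
  z * ev e Y v = ev e Y u ->
  Y * ev e Y v * w = ev e Y (cder f u) - z * ev e Y (cder f v).

Lemma quotient_rule_ex z : exists w, quotient_rule z w.
Proof.
have [u [v [v0 zv]]] := chart_frac chart z.
have Y0 := ordinate_neq0 chart.
exists ((ev e Y (cder f u) - z * ev e Y (cder f v)) / (Y * ev e Y v)).
move=> u' v' v0' zv'; apply: (mulfI v0).
have : cmul f u v' = cmul f u' v.
  by apply: (ev_inj chart); rewrite !evM // -zv -zv'; ring.
move=> /(congr1 (ev e Y \o cder f)) /=.
rewrite !cderM !evD !evM // -zv -zv' => h.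
transitivity (ev e Y v' * (ev e Y (cder f u) - z * ev e Y (cder f v))).
  by field; rewrite v0 Y0.
rewrite mulrBr -[ev e Y v' * ev e Y (cder f u)](addKr
  (z * ev e Y v * ev e Y (cder f v'))) h.
by ring.
Qed.

(** The derivation d/dX of the coordinate ring is cder divided by Y. It extends
    to fractions by the quotient rule, whose value is independent of the
    fraction because cder satisfies the product rule. *)
Lemma derivation_ex : exists D : K -> K,
  [/\ forall u v, D (u + v) = D u + D v,
      forall u v, D (u * v) = u * D v + v * D u,
      forall c, D (e c%:P) = 0 & D (e 'X) = 1].
Proof.
have [D hD] := choice quotient_rule_ex; exists D.
have Y0 := ordinate_neq0 chart.
have frac := chart_frac chart.
have cancel v v' z w : ev e Y v != 0 -> ev e Y v' != 0 ->
    Y * (ev e Y v * ev e Y v') * z = Y * (ev e Y v * ev e Y v') * w -> z = w.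
  by move=> v0 v0'; apply: mulfI; rewrite !mulf_neq0.
have solve z u v : ev e Y v != 0 -> z * ev e Y v = ev e Y u ->
    ev e Y (cder f u) = Y * ev e Y v * D z + z * ev e Y (cder f v).
  by move=> v0 zv; rewrite (hD z u v) // subrK.
have De a : D (e a) = e a^`().
  apply: (mulfI Y0).
  have := hD (e a) (a, 0) (1, 0).
  rewrite !ev_poly rmorph1 oner_eq0 !mulr1 => -> //.
  have -> : cder f (1, 0) = (0, 0).
    by rewrite /cder /= deriv0 !mul0r scaler0 addr0 -polyC1 derivC.
  have -> : cder f (a, 0) = (0, a^`()).
    by rewrite /cder /= deriv0 !mul0r scaler0 addr0.
  by rewrite /ev /= !rmorph0 mul0r add0r addr0 mulr0 subr0 mulrC.
split.
- move=> z z'.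
  have [u [v [v0 zv]]] := frac z; have [u' [v' [v0' zv']]] := frac z'.
  apply: (cancel v v' _ _ v0 v0').
  have := hD (z + z') (cmul f u v' + cmul f u' v) (cmul f v v').
  rewrite evM // => ->; rewrite ?mulf_neq0 //; last first.
    by rewrite evD !evM // -zv -zv'; ring.
  rewrite cderD !cderM !evD !evM // (solve z u v) // (solve z' u' v') //.
  by rewrite -zv -zv'; ring.
- move=> z z'.
  have [u [v [v0 zv]]] := frac z; have [u' [v' [v0' zv']]] := frac z'.
  apply: (cancel v v' _ _ v0 v0').
  have := hD (z * z') (cmul f u u') (cmul f v v').
  rewrite evM // => ->; rewrite ?mulf_neq0 //; last first.
    by rewrite !evM // -zv -zv'; ring.
  rewrite !cderM !evD !evM // (solve z u v) // (solve z' u' v') //.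
  by rewrite -zv -zv'; ring.
- by move=> c; rewrite De derivC rmorph0.
- by rewrite De derivX rmorph1.
Qed.

End DerivationExists.

(** * The Cartier operator on y^-p F[x] *)

(** As the size of a is at most m, the products of a with the powers X^(j m)
    occupy disjoint ranges of exponents. *)
Lemma coef_mul_expXnD1 (R : comNzRingType) (a : {poly R}) m n i j :
  (size a <= m)%N -> (i < m)%N ->
  (a * ('X^m + 1) ^+ n)`_(i + j * m) = a`_i *+ 'C(n, j).
Proof.
move=> size_a im; rewrite exprD1n mulr_sumr coef_sum.
have term (k : nat) : (a * ('X^m ^+ k *+ 'C(n, k)))`_(i + j * m) =
    (if k == j then a`_i *+ 'C(n, j) else 0).
  rewrite -exprM mulrnAr coefMn coefMXn.
  have [->|kj] := eqVneq k j; first by rewrite ltnNge mulnC leq_addl /= addnK.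
  case: ltnP => [_|le]; first by rewrite mul0rn.
  rewrite nth_default ?mul0rn //; apply: (leq_trans size_a).
  by move: kj le im; nia.
under eq_bigr => k _ do rewrite term.
rewrite -big_mkcond /=.
have [nj|jn] := ltnP n j.
  by rewrite bin_small // mulr0n big1.
by rewrite (big_pred1 (Ordinal (jn : (j < n.+1)%N))).
Qed.

Lemma prime_bin_ndvd p n k : prime p -> (n < p)%N -> (k <= n)%N ->
  ~~ (p %| 'C(n, k))%N.
Proof.
move=> pr_p np kn; apply/negP => pC.
have : (p %| n`!)%N by rewrite -(bin_fact kn) dvdn_mulr.
rewrite fact_prod big_nat_cond; elim/big_ind: _ => [|x y hx hy|i].
- by rewrite dvdn1 => /eqP p1; rewrite p1 in pr_p.
- by rewrite Euclid_dvdM // => /orP [].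
- by move=> /andP [/andP [i0 ip] _] /dvdn_leq; move: i0 ip np; lia.
Qed.

Lemma prime_ffact_ndvd p k : prime p -> ~~ (p %| (p.-1 + k * p) ^_ p.-1)%N.
Proof.
move=> pr_p; have p_gt0 := prime_gt0 pr_p; rewrite ffact_prod; apply/negP.
elim/big_ind: _ => [|x y hx hy|i _].
- by rewrite dvdn1 => /eqP p1; rewrite p1 in pr_p.
- by rewrite Euclid_dvdM // => /orP [].
have ip := ltn_ord i.
have -> : (p.-1 + k * p - i = k * p + (p.-1 - i))%N by move: ip; lia.
by rewrite dvdn_addr ?dvdn_mull // => /dvdn_leq; move: ip p_gt0; lia.
Qed.

Section Cartier.

Variables (F : closedFieldType) (K : fieldType).
Variables (e : {rmorphism {poly F} -> K}) (p : nat) (D : K -> K).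
Hypothesis e_inj : forall a, e a = 0 -> a = 0.
Hypothesis charF : p \in [pchar F].
Hypothesis DD : forall u v, D (u + v) = D u + D v.
Hypothesis DM : forall u v, D (u * v) = u * D v + v * D u.
Hypothesis De : forall a, D (e a) = e a^`().

Let pr_p : prime p. Proof. exact: pcharf_prime charF. Qed.

Let charK : p \in [pchar K].
Proof. exact: rmorph_pchar e _ (rmorph_pchar polyC charF). Qed.

Let D0 : D 0 = 0.
Proof. by rewrite -(rmorph0 e) De deriv0. Qed.

Lemma iter_derD n u v : iter n D (u + v) = iter n D u + iter n D v.
Proof. by elim: n => //= n ->. Qed.

Lemma iter_der_const n c z : D c = 0 -> iter n D (c * z) = c * iter n D z.
Proof. by move=> c0; elim: n => //= n ->; rewrite DM c0 mulr0 addr0. Qed.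

Lemma iter_der_poly n a : iter n D (e a) = e a^`(n).
Proof. by elim: n => [|n IHn] //; rewrite iterS IHn De derivnS. Qed.

Lemma der_expp z : D (z ^+ p) = 0.
Proof.
have DX n : D (z ^+ n) = (n%:R * z ^+ n.-1) * D z.
  elim: n => [|n IHn]; first
    by rewrite expr0 -(rmorph1 e) De -polyC1 derivC rmorph0 !mul0r.
  case: n IHn => [|n] IHn; first by rewrite expr1 expr0 mul1r mul1r.
  by rewrite exprS DM IHn /= [in RHS]mulrS exprS; ring.
by rewrite DX (pcharf0 charK) !mul0r.
Qed.

(** This says that the Cartier operator maps z dX to 0. *)
Definition cartier_free z := exists g : nat -> K,
  z = \sum_(i < p) g i ^+ p * e 'X ^+ i /\ g p.-1 = 0.

Lemma cartier_free_der z : cartier_free z -> iter p.-1 D z = 0.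
Proof.
move=> [g [-> g0]]; elim/big_ind: _ => [|u v hu hv|i _].
- by elim: p.-1 => //= n ->.
- by rewrite iter_derD hu hv addr0.
rewrite iter_der_const ?der_expp // -rmorphXn iter_der_poly.
have [->|ip] := eqVneq (i : nat) p.-1.
  by rewrite g0 expr0n gtn_eqF ?prime_gt0 // mul0r.
rewrite derivn_poly0 ?rmorph0 ?mulr0 // size_polyXn.
by have := ltn_ord i; move: ip; lia.
Qed.

Lemma cartier_freeD u v :
  cartier_free u -> cartier_free v -> cartier_free (u + v).
Proof.
move=> [g [-> g0]] [h [-> h0]]; exists (fun i => g i + h i).
rewrite g0 h0 addr0 -big_split /=; split=> //; apply: eq_bigr => i _.
by rewrite -mulrDl exprDn_pchar // pnatE.
Qed.

Lemma cartier_freeM c z : cartier_free z -> cartier_free (c ^+ p * z).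
Proof.
move=> [g [-> g0]]; exists (fun i => c * g i); rewrite g0 mulr0; split=> //.
by rewrite mulr_sumr; apply: eq_bigr => i _; rewrite exprMn mulrA.
Qed.

Lemma cartier_free0 : cartier_free 0.
Proof.
exists (fun=> 0); split=> //; rewrite big1 // => i _.
by rewrite expr0n gtn_eqF ?prime_gt0 // mul0r.
Qed.

Lemma cartier_free_Xn k : (k %% p)%N != p.-1 -> cartier_free (e 'X ^+ k).
Proof.
move=> kp; exists (fun i => if i == (k %% p)%N then e 'X ^+ (k %/ p) else 0).
rewrite eq_sym (negPf kp); split=> //.
have kp' : (k %% p < p)%N by rewrite ltn_pmod ?prime_gt0.
rewrite (bigD1 (Ordinal kp')) //= eqxx -exprM -exprD -divn_eq big1 ?addr0 //.
move=> i; rewrite -val_eqE /= => /negPf ->.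
by rewrite expr0n gtn_eqF ?prime_gt0 // mul0r.
Qed.

(** If the form is killed, the (p-1)-st derivative of q vanishes; it sends X^k
    to a multiple of X^(k-p+1) by a falling factorial that is nonzero modulo p
    when k = -1 mod p. *)
Lemma cartier_free_poly b q : b != 0 ->
  cartier_free (b ^+ p * e q) <-> forall k, (k %% p)%N = p.-1 -> q`_k = 0.
Proof.
move=> b0; split=> [/cartier_free_der|q0].
  rewrite iter_der_const ?der_expp // iter_der_poly => /eqP.
  rewrite mulf_eq0 expf_eq0 (negPf b0) andbF => /eqP /e_inj q0 k kp.
  have def_k : k = (p.-1 + k %/ p * p)%N by rewrite [LHS](divn_eq k p) kp addnC.
  have := congr1 (fun r : {poly F} => r`_(k %/ p * p)) q0.
  rewrite coef_derivn coef0 -def_k => /eqP; rewrite -mulr_natr mulf_eq0.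
  rewrite -(dvdn_pcharf charF) {2}def_k.
  by rewrite (negPf (prime_ffact_ndvd _ pr_p)) orbF => /eqP.
apply: cartier_freeM.
rewrite -[q]coefK poly_def rmorph_sum.
elim/big_ind: _ => [||i _]; [exact: cartier_free0|exact: cartier_freeD|].
have [/q0 ->|ip] := eqVneq (i %% p)%N p.-1.
  by rewrite scale0r rmorph0; exact: cartier_free0.
have [a <-] := nth_root_exists q`_i (prime_gt0 pr_p).
rewrite -mul_polyC rmorphM polyC_exp !rmorphXn.
exact: cartier_freeM (cartier_free_Xn ip).
Qed.

End Cartier.

(** The exponents j m of (X^m + 1)^n have residues j = 0, ..., n modulo p, so
    those of X^i (X^m + 1)^n reach the residue p - 1 = 2n exactly when i mod p
    is at least n; the coefficient there is a binomial coefficient of n < p. *)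
Lemma coef_cartier (F : fieldType) (p m n : nat) (a : {poly F}) :
  p \in [pchar F] -> p = n.*2.+1 -> (m %% p)%N = 1%N -> (size a <= m)%N ->
  (forall k, (k %% p)%N = p.-1 -> (a * ('X^m + 1) ^+ n)`_k = 0) <->
  (forall i, (n <= i %% p)%N -> a`_i = 0).
Proof.
move=> charF def_p m1 size_a; have pr_p := pcharf_prime charF.
have m_gt0 : (0 < m)%N by case: m m1 {size_a} => //; rewrite mod0n.
have modm i j : ((i + j * m) %% p = (i + j) %% p)%N.
  by rewrite -modnDmr -modnMmr m1 muln1 modnDmr.
split=> h.
- move=> i ni; have [im|mi] := ltnP i m; last first.
    by rewrite nth_default // (leq_trans size_a).
  have ip : (i %% p < p)%N by rewrite ltn_pmod ?prime_gt0.
  have := h (i + (p.-1 - i %% p) * m)%N; rewrite coef_mul_expXnD1 // modm.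
  rewrite -modnDml subnKC; last by move: ip; lia.
  rewrite modn_small ?ltn_predL ?prime_gt0 // => /(_ erefl) /eqP.
  rewrite -mulr_natr mulf_eq0 -(dvdn_pcharf charF) 
    (negPf (prime_bin_ndvd _ _ _)) //.
  + by rewrite orbF => /eqP.
  + by rewrite def_p; lia.
  + by move: ni; rewrite {2}def_p; lia.
- move=> k kp; rewrite (divn_eq k m) addnC coef_mul_expXnD1 ?ltn_pmod //.
  set i := (k %% m)%N; set j := (k %/ m)%N.
  have [nj|jn] := ltnP n j; first by rewrite bin_small // mulr0n.
  have [/h ->|ni] := leqP n (i %% p)%N; first by rewrite mul0rn.
  have ij : (i %% p + j < p.-1)%N.
    by move: (i %% p)%N ni => r ni; move: ni jn; rewrite def_p; lia.
  move: kp ij; rewrite (divn_eq k m) addnC -/i -/j modm -modnDml => <-.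
  by rewrite ltnNge leq_mod.
Qed.

(** * The two affine charts of y^2 = x^m + 1 *)

(** At a root al of the separable polynomial f, the order of vanishing of a^2
    is even and that of b^2 f is odd, so a^2 = b^2 f only if a = b = 0. *)
Lemma chart_independent (F : closedFieldType) (K : fieldType) (f : {poly F})
    (e : {rmorphism {poly F} -> K}) (Y : K) u :
  (forall a, e a = 0 -> a = 0) -> Y ^+ 2 = e f -> separable_poly f ->
  (1 < size f)%N -> ev e Y u = 0 -> u = 0.
Proof.
move=> e_inj hY f_sep size_f u0.
have /eqP : cnorm f u = 0 by apply: e_inj; rewrite -(ev_conj hY) u0 mul0r.
rewrite subr_eq0 => /eqP u12.
have f0 := separable_poly_neq0 f_sep.
have [u2|u2] := eqVneq u.2 0.
  move/eqP: u12; rewrite u2 expr0n mul0r sqrf_eq0 => /eqP.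
  by case: (u) u2 => a b /= -> ->.
have u1 : u.1 != 0 by rewrite -sqrf_eq0 u12 mulf_neq0 ?sqrf_eq0.
have /closed_rootP [al /factor_theorem [g fg]] : size f != 1%N.
  by rewrite gtn_eqF.
have mup_f : mup al f = 1%N.
  move: f_sep; rewrite fg separable_root => /andP [_ gal].
  by rewrite mupMr // -['X - _]expr1 mup_XsubCX eqxx.
have := congr1 (fun q => odd (mup al q)) u12.
by rewrite /= !expr2 !mupM ?mulf_neq0 // mup_f addn1 !addnn /= !odd_double.
Qed.

Definition rev_poly (R : nzRingType) N (a : {poly R}) : {poly R} :=
  \poly_(i < N.+1) a`_(N - i).

Section Charts.

Variables (F : closedFieldType) (K : fieldType).

Lemma rmorph_poly_sum (e : {rmorphism {poly F} -> K}) N (E : nat -> F) :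
  e (\poly_(i < N) E i) = \sum_(i < N) e (E i)%:P * e 'X ^+ i.
Proof.
by rewrite poly_def rmorph_sum; apply: eq_bigr => i _;
  rewrite -mul_polyC rmorphM rmorphXn.
Qed.

Lemma rmorph_rev_poly (e e' : {rmorphism {poly F} -> K}) N (a : {poly F}) :
  (forall c, e' c%:P = e c%:P) -> e 'X * e' 'X = 1 -> (size a <= N.+1)%N ->
  e' (rev_poly N a) = e' 'X ^+ N * e a.
Proof.
move=> eC xt size_a.
have -> : a = \poly_(i < N.+1) a`_i.
  apply/polyP => i; rewrite coef_poly; case: ltnP => // iN.
  by rewrite nth_default // (leq_trans size_a).
rewrite !rmorph_poly_sum mulr_sumr (reindex_inj rev_ord_inj) /=.
apply: eq_bigr => i _; have iN : (i <= N)%N by rewrite -ltnS.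
have -> : e' 'X ^+ N = e' 'X ^+ (N - i) * e' 'X ^+ i.
  by rewrite -exprD subnK.
rewrite subSS subKn // eC coef_poly ltnS iN.
transitivity (e (a`_i)%:P * e' 'X ^+ (N - i) * (e 'X * e' 'X) ^+ i).
  by rewrite xt expr1n mulr1.
by rewrite exprMn; ring.
Qed.

Lemma swap_charts (e e' : {rmorphism {poly F} -> K}) (Y Y' : K) n N
    (u : {poly F} * {poly F}) :
  (forall c, e' c%:P = e c%:P) -> e 'X * e' 'X = 1 -> Y' = Y * e' 'X ^+ n ->
  (size u.1 <= N.+1)%N -> (size u.2 <= N.+1)%N ->
  ev e' Y' ('X^n * rev_poly N u.1, rev_poly N u.2) =
  e' 'X ^+ (N + n) * ev e Y u.
Proof.
move=> eC xt -> s1 s2; rewrite /ev /= rmorphM rmorphXn.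
by rewrite !(rmorph_rev_poly eC xt) // exprD; ring.
Qed.

Variables (m g : nat).
Hypothesis m_neq0 : m%:R != 0 :> F.
Hypothesis genus : (g.*2.+1 <= m <= g.*2.+2)%N.

Lemma degree_neq0 : m != 0%N.
Proof. by apply: contra_neq m_neq0 => ->. Qed.

(** With h = X^m + 1, one has h - X h' / m = 1. *)
Lemma separable_XnD1 : separable_poly ('X^m + 1 : {poly F}).
Proof.
rewrite separable_poly.unlock; apply/Bezout_eq1_coprimepP.
exists (1, - (m%:R^-1)%:P * 'X) => /=.
case: m m_neq0 => [|m']; first by rewrite eqxx.
move=> m0; rewrite mul1r derivD derivXn -polyC1 derivC addr0 polyC1 succnK.
rewrite -scaler_nat -mul_polyC exprS.
have -> : - (m'.+1%:R^-1)%:P * 'X * ((m'.+1%:R)%:P * 'X^m') =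
   - (((m'.+1%:R^-1)%:P * (m'.+1%:R)%:P) * ('X * 'X^m')) :> {poly F} by ring.
by rewrite -polyCM mulVf // mul1r addrAC subrr add0r.
Qed.

Lemma size_XnD1 : size ('X^m + 1 : {poly F}) = m.+1.
Proof.
by rewrite size_polyDl size_polyXn // size_poly1 ltnS lt0n degree_neq0.
Qed.

(** With t = 1/x and y' = y / x^(g+1), this is y'^2 as a polynomial in t. *)
Definition infinity_poly : {poly F} := 'X^(g.*2.+2 - m) * ('X^m + 1).

Lemma infinity_chart (e e' : {rmorphism {poly F} -> K}) (Y : K) :
  is_chart ('X^m + 1) e Y ->
  (forall c, e' c%:P = e c%:P) -> e 'X * e' 'X = 1 ->
  is_chart infinity_poly e' (Y * e' 'X ^+ g.+1).
Proof.
move=> chart eC xt; have hY : Y ^+ 2 = e ('X^m + 1) by case: chart.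
have sep : separable_poly infinity_poly.
  rewrite /infinity_poly.
  have /orP [/eqP -> | /eqP ->] : (g.*2.+2 - m == 0)%N || (g.*2.+2 - m == 1)%N.
  - by move: genus; lia.
  - by rewrite expr0 mul1r separable_XnD1.
  rewrite expr1 mulrC -[X in _ * X]subr0 -polyC0 separable_root separable_XnD1.
  by rewrite /root !hornerE expr0n (negPf degree_neq0) add0r oner_eq0.
have hY' : (Y * e' 'X ^+ g.+1) ^+ 2 = e' infinity_poly.
  have yt : ((Y * e' 'X ^+ g.+1) ^+ 2 =
      e ('X^m + 1) * (e' 'X ^+ (g.*2.+2 - m) * e' 'X ^+ m)).
    rewrite -exprD subnK; last by case/andP: genus.
    by rewrite exprMn hY -exprM muln2.
  rewrite yt rmorphM !rmorphD !rmorphXn !rmorph1.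
  transitivity (e' 'X ^+ (g.*2.+2 - m) * ((e 'X * e' 'X) ^+ m + e' 'X ^+ m)).
    by rewrite exprMn; ring.
  by rewrite xt expr1n addrC.
have e'_inj a : e' a = 0 -> a = 0.
  move=> a0; have xt' : e' 'X * e 'X = 1 by rewrite mulrC.
  have eC' c : e c%:P = e' c%:P by rewrite eC.
  have := rmorph_rev_poly eC' xt' (leqnSn (size a)).
  rewrite a0 mulr0 => /(chart_poly_eq0 chart) rev0.
  apply/polyP => i; rewrite coef0.
  have [ia|ai] := ltnP i (size a); last by rewrite nth_default.
  have := congr1 (fun q : {poly F} => q`_(size a - i)) rev0.
  rewrite coef0 coef_poly ltnS leq_subr subKn //; exact: ltnW.
split=> //.
  move=> u; apply: (chart_independent e'_inj hY' sep).
  have P0 : 'X^m + 1 != 0 :> {poly F} by rewrite -size_poly_eq0 size_XnD1.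
  rewrite /infinity_poly mulrC size_mulXn // size_XnD1.
  by have := degree_neq0; lia.
move=> z; have [u [v [v0 zv]]] := chart_frac chart z.
pose N := (size u.1 + size u.2 + size v.1 + size v.2)%N.
have swap (w : {poly F} * {poly F}) : (size w.1 <= N)%N -> (size w.2 <= N)%N ->
   ev e' (Y * e' 'X ^+ g.+1) ('X^(g.+1) * rev_poly N w.1, rev_poly N w.2) =
  e' 'X ^+ (N + g.+1) * ev e Y w.
  by move=> w1 w2; apply: swap_charts => //; rewrite ltnW.
exists ('X^(g.+1) * rev_poly N u.1, rev_poly N u.2).
exists ('X^(g.+1) * rev_poly N v.1, rev_poly N v.2).
have t0 : e' 'X != 0.
  by apply/eqP => t0; move/eqP: xt; rewrite t0 mulr0 eq_sym oner_eq0.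
have [u1 u2] : (size u.1 <= N)%N /\ (size u.2 <= N)%N by rewrite /N; lia.
have [v1 v2] : (size v.1 <= N)%N /\ (size v.2 <= N)%N by rewrite /N; lia.
by rewrite !swap // mulf_neq0 ?expf_neq0 // mulrCA zv.
Qed.

(** Up to sign, x^2 u t^(g+1) is the coefficient of dt / y' in u dx / y. If it
    is a polynomial in t and y', clearing the powers of t bounds the degrees of
    the two coordinates of u by g - 1 and -2. *)
Lemma integral_at_infinity (e e' : {rmorphism {poly F} -> K}) (Y : K)
    (u : {poly F} * {poly F}) :
  (0 < g)%N -> is_chart ('X^m + 1) e Y ->
  (forall c, e' c%:P = e c%:P) -> e 'X * e' 'X = 1 ->
  (exists r, e 'X ^+ 2 * ev e Y u * e' 'X ^+ g.+1 =
     ev e' (Y * e' 'X ^+ g.+1) r) <->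
  (size u.1 <= g)%N /\ u.2 = 0.
Proof.
move=> g_gt0 chart eC xt; have xtX n : e 'X ^+ n * e' 'X ^+ n = 1.
  by rewrite -exprMn xt expr1n.
split=> [[r hr]|[size_u u2]]; last first.
  exists (rev_poly g.-1 u.1, 0).
  rewrite ev_poly (rmorph_rev_poly eC xt) ?prednK // /ev u2 rmorph0 mul0r addr0.
  have -> : g.+1 = (2 + g.-1)%N by lia.
  by rewrite exprD -[RHS]mul1r -(xtX 2); ring.
pose N := (size r.1 + size r.2)%N.
have [r1 r2] : (size r.1 <= N.+1)%N /\ (size r.2 <= N.+1)%N by rewrite /N; lia.
have tx : e' 'X * e 'X = 1 by rewrite mulrC.
have eC' c : e c%:P = e' c%:P by rewrite eC.
have hY : Y = Y * e' 'X ^+ g.+1 * e 'X ^+ g.+1.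
  by rewrite -mulrA [e' _ ^+ _ * _]mulrC xtX mulr1.
have := swap_charts eC' tx hY r1 r2; rewrite -hr.
have -> : e 'X ^+ (N + g.+1) * (e 'X ^+ 2 * ev e Y u * e' 'X ^+ g.+1) =
    ev e Y ('X^(N + 2) * u.1, 'X^(N + 2) * u.2).
  transitivity (e 'X ^+ (N + 2) * ev e Y u).
    by rewrite -[RHS]mulr1 -(xtX g.+1) !exprD; ring.
  by rewrite /ev /= !rmorphM !rmorphXn; ring.
move=> /(ev_inj chart) [/esym eq1 /esym eq2].
have size_rev q : (size (rev_poly N q : {poly F}) <= N.+1)%N by exact: size_poly.
have size_XnM n (q : {poly F}) : q != 0 -> size ('X^n * q) = (n + size q)%N.
  by move=> q0; rewrite mulrC size_mulXn // addnC.
split.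
  have [->|u1] := eqVneq u.1 0; first by rewrite size_poly0.
  have rev0 : rev_poly N r.1 != 0.
    apply: contra_neq u1 => rev0; move/eqP: eq1; rewrite rev0 mulr0.
    by rewrite mulf_eq0 expf_eq0 polyX_eq0 andbF => /eqP.
  move/(congr1 (fun q : {poly F} => size q)): eq1 => /=.
  rewrite !size_XnM //; move: (size_rev r.1).
  by move: (size (rev_poly N r.1)) (size u.1) => a b; lia.
apply/eqP; apply/negPn/negP => u2.
move/(congr1 (fun q : {poly F} => size q)): eq2 => /=.
rewrite size_XnM //; move: u2 (size_rev r.2); rewrite -size_poly_gt0.
by move: (size (rev_poly N r.2)) (size u.2) => a b; lia.
Qed.

End Charts.

(** * Regular differentials on a chart *)

HB.instance Definition _ (F : fieldType) (K : fieldExtType {fraction {poly F}}) :=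
  GRing.RMorphism.copy (@of_poly F K) (in_alg K \o @tofrac {poly F}).

HB.instance Definition _ (F : fieldType) (K : fieldExtType {fraction {poly F}}) :=
  GRing.RMorphism.copy (@cst F K) (@of_poly F K \o polyC).

Section RegularOnChart.

Variables (F : closedFieldType) (K : fieldExtType {fraction {poly F}}).
Variables (f : {poly F}) (e : {rmorphism {poly F} -> K}) (Y : K).
Hypothesis chart : is_chart f e Y.
Hypothesis e_cst : forall c, e c%:P = cst K c.
Hypothesis two_neq0 : 2%:R != 0 :> F.
Variables (Omega : lmodType K) (d : K -> Omega).
Hypothesis hd : is_derivation d.

Let dC c : d (e c%:P) = 0. Proof. by case: hd => _ _; rewrite e_cst; apply. Qed.

Lemma local_ring_place al be : be ^+ 2 = f.[al] ->
  is_place (local_ring e Y al be).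
Proof.
move=> hP; split.
- exact: (local_ring_subring chart hP).
- by move=> c; rewrite -e_cst -(ev_poly e Y); exact: ev_local.
- exact: (local_ring_proper chart hP).
- exact: (local_ring_valuation chart two_neq0 hP).
Qed.

Lemma integral_of_holomorphic z : d (e 'X) != 0 ->
  holomorphic d (z *: d (e 'X)) -> exists u, z * Y = ev e Y u.
Proof.
case: hd => dD dM _ dX0 hol; apply: (integral_of_local chart two_neq0).
move=> al be hP; have [n [h [u [hu zE]]]] := hol _ (local_ring_place hP).
exact: (regular_in_local_ring chart two_neq0 dD dM dC dX0 hP hu zE).
Qed.

(** A valuation ring that contains X contains F[X, Y], being integrally closed,
    and dX / Y is a combination of dX and dY over F[X, Y]. *)
Lemma regular_of_integral (O : {pred K}) z u : is_place O -> e 'X \in O ->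
  z * Y = ev e Y u -> regular_at d O (z *: d (e 'X)).
Proof.
move=> [[O1 OB OM] Oc _ Oval] XO zY.
have O0 : 0 \in O by rewrite -(subrr 1) OB.
have OD a b : a \in O -> b \in O -> a + b \in O.
  by move=> aO bO; rewrite -[b]opprK -[- b]sub0r !OB.
have Oe a : e a \in O.
  elim/poly_ind: a => [|a c IHa]; first by rewrite rmorph0.
  by rewrite rmorphD rmorphM OD ?OM // e_cst.
have hY : Y ^+ 2 = e f by case: chart.
have YO : Y \in O.
  have [//|YV] := Oval Y.
  have -> : Y = Y ^+ 2 * Y^-1.
    by rewrite expr2 mulfK // (ordinate_neq0 chart).
  by rewrite OM // hY.
case: hd => dD dM _.
have [r dX] := ordinate_diff chart dD dM dC.
have zYO : z * Y \in O by rewrite zY /ev OD ?OM.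
exists 2%N, (fun i : 'I_2 =>
  if i == 0 then z * Y * (e r.1 * Y) else z * Y * (e r.2 * 2%:R)).
exists (fun i : 'I_2 => if i == 0 then e 'X else Y); split.
  have O2 : (2%:R : K) \in O by rewrite mulr2n OD.
  by move=> i; case: ifP => _; split=> //; apply: (OM) => //; apply: (OM).
rewrite !big_ord_recl big_ord0 addr0 /=.
by rewrite [in LHS]dX scalerA scalerDr !scalerA.
Qed.

End RegularOnChart.

(** * The function field of a double cover *)

Lemma fraction_exists (R : idomainType) (q : {fraction R}) :
  exists a b : R, b != 0 /\ q * tofrac b = tofrac a.
Proof.
elim/quotW: q => r; exists \n_r, \d_r; split; first exact: denom_ratioP.
unlock tofrac; rewrite -[LHS]FracField.pi_mul; apply/eqmodP => /=.
rewrite FracField.equivfE /FracField.mulf !numden_Ratio ?mulr1 ?oner_neq0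
  ?denom_ratioP //.
by rewrite mulrC.
Qed.

Section FunctionFieldOfCover.

Variables (F : closedFieldType) (K : fieldExtType {fraction {poly F}}).
Variables (f : {poly F}) (y : K).
Hypothesis cover : is_double_cover f y.
Hypothesis f_sep : separable_poly f.
Hypothesis size_f : (1 < size f)%N.

Lemma of_poly_eq0 a : of_poly K a = 0 -> a = 0.
Proof.
by move=> /eqP; rewrite /of_poly scaler_eq0 oner_eq0 orbF tofrac_eq0 => /eqP.
Qed.

Lemma cover_chart : is_chart f (@of_poly F K) y.
Proof.
case: cover => hY gen.
have indep u : ev (@of_poly F K) y u = 0 -> u = 0.
  by apply: (chart_independent of_poly_eq0 hY f_sep size_f).
split=> // z.
have : z \in <<1%VS; y>>%VS by rewrite gen memvf.
move=> /Fadjoin_polyP [q /polyOverP q1 ->].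
suff [u [b [b0 hu]]] : exists u b,
    b != 0 /\ q.[y] * of_poly K b = ev (@of_poly F K) y u.
  exists u, (b, 0); rewrite ev_poly; split=> //.
  by apply: contra_neq b0; exact: of_poly_eq0.
elim/poly_ind: q q1 => [|q c IHq] q1.
  exists 0, 1; rewrite oner_eq0 horner0 mul0r /ev rmorph0; split=> //.
  by rewrite mul0r addr0.
have [u [b [b0 hu]]] : exists u b,
    b != 0 /\ q.[y] * of_poly K b = ev (@of_poly F K) y u.
  apply: IHq => i; have := q1 i.+1.
  by rewrite coefD coefMX coefC /= addr0.
have /vlineP [k ck] : c \in 1%VS.
  by have := q1 0%N; rewrite coefD coefMX coefC add0r.
have [a' [b' [b'0 hk]]] := fraction_exists k.
exists (cmul f u (0, b') + (a' * b, 0)), (b * b'); split; first exact: mulf_neq0.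
rewrite evD (evM hY) ev_poly {2}/ev rmorph0 add0r -hu !rmorphM /=.
have -> : of_poly K a' = c * of_poly K b'.
  by rewrite /of_poly -hk ck -scalerAl mul1r scalerA.
by rewrite hornerMXaddC; ring.
Qed.

End FunctionFieldOfCover.

(** * The line of differentials *)

Section Kaehler.

Variables (F : fieldType) (K : fieldExtType {fraction {poly F}}).
Variables (f : {poly F}) (e : {rmorphism {poly F} -> K}) (Y : K).
Hypothesis chart : is_chart f e Y.
Hypothesis e_cst : forall c, e c%:P = cst K c.
Hypothesis two_neq0 : 2%:R != 0 :> F.
Variables (Omega : lmodType K) (d : K -> Omega).
Hypothesis hd : is_Kaehler d.

(** The derivation d/dX makes Omega a line: the linear form that it induces
    has value 1 at dX, and the universal property of Omega recovers every
    differential from its value under that form. *)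
Lemma Kaehler_line :
  d (e 'X) != 0 /\ forall w : Omega, exists z, w = z *: d (e 'X).
Proof.
have [D [DD DM DC DX]] := derivation_ex chart two_neq0.
case: hd => der_d univ; case: (der_d) => dD dM dC.
have dC' c : d (e c%:P) = 0 by rewrite e_cst dC.
have derD : is_derivation (D : K -> K^o).
  by split=> [||c]; [exact: DD|exact: DM|rewrite -e_cst; exact: DC].
have [phi phi_d _] := univ _ _ derD.
have [psi psi_d psi_uniq] := univ _ _ der_d.
have dX0 : d (e 'X) != 0.
  apply/eqP => dX0; have /eqP := phi_d (e 'X).
  by rewrite dX0 linear0 DX eq_sym oner_eq0.
split=> // w; exists (phi w).
pose line w' : Omega := (phi w' : K) *: d (e 'X).
have line_lin : linear line.
  by move=> a u v; rewrite /line linearP scalerDl scalerA.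
pose lineL : {linear Omega -> Omega} :=
  HB.pack line (GRing.isLinear.Build _ _ _ _ line line_lin).
have line_d z : lineL (d z) = d z.
  rewrite /= /line phi_d.
  have [u [v [v0 zv]]] := chart_frac chart z.
  have Yv : Y * ev e Y v != 0 by rewrite mulf_neq0 // (ordinate_neq0 chart).
  apply: (scalerI Yv); rewrite scalerA.
  rewrite (der_frac chart two_neq0 dD dM dC' zv).
  have := der_frac chart two_neq0 (M := K^o) DD DM DC zv.
  by rewrite DX /GRing.scale /= mulr1 => ->.
have := psi_uniq lineL line_d w.
by rewrite -(psi_uniq idfun (fun=> erefl) w) /=.
Qed.

End Kaehler.

(** * Counting the monomials killed by the Cartier operator *)

Section Monomials.

Variables (F : fieldType) (p n g k : nat).
Hypothesis n_lt_p : (n < p)%N.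
Hypothesis n_gt0 : (0 < n)%N.
Hypothesis in_range : forall i, (i %% p < n)%N -> (i < g)%N = (i %/ p < k)%N.

(** The j-th exponent whose residue modulo p is below n. *)
Definition exponent (j : nat) := (j %/ n * p + j %% n)%N.

Lemma exponent_mod j : (exponent j %% p = j %% n)%N.
Proof. by rewrite modnMDl modn_small // (ltn_trans _ n_lt_p) // ltn_pmod. Qed.

Lemma exponent_div j : (exponent j %/ p = j %/ n)%N.
Proof.
have jp : (j %% n < p)%N by rewrite (ltn_trans _ n_lt_p) // ltn_pmod.
by rewrite divnMDl ?(leq_ltn_trans _ n_lt_p) // (divn_small jp) addn0.
Qed.

Lemma exponent_inj : injective exponent.
Proof.
move=> i j ij; rewrite (divn_eq i n) (divn_eq j n).
by rewrite -!exponent_div -!exponent_mod ij.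
Qed.

Lemma coef_exponent_sum (c : 'I_(k * n) -> F) (i : 'I_(k * n)) :
  (\sum_j (c j)%:P * 'X^(exponent j) : {poly F})`_(exponent i) = c i.
Proof.
rewrite coef_sum (bigD1 i) //= big1 => [|j ji].
  by rewrite addr0 coefCM coefXn eqxx mulr1.
rewrite coefCM coefXn (inj_eq exponent_inj) (inj_eq val_inj) eq_sym.
by rewrite (negPf ji) mulr0.
Qed.

Lemma monomial_span (a : {poly F}) :
  (size a <= g)%N /\ (forall i, (n <= i %% p)%N -> a`_i = 0) <->
  exists c : 'I_(k * n) -> F, a = \sum_j (c j)%:P * 'X^(exponent j).
Proof.
have p_gt0 : (0 < p)%N by rewrite (leq_ltn_trans _ n_lt_p).
split=> [[size_a a0]|[c ->]].
  exists (fun j => a`_(exponent j)); apply/polyP => i.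
  have vanish : (forall j : 'I_(k * n), exponent j != i) ->
      (\sum_(j < k * n) (a`_(exponent j))%:P * 'X^(exponent j) : {poly F})`_i = 0.
    move=> hi; rewrite coef_sum big1 // => j _.
    by rewrite coefCM coefXn eq_sym (negPf (hi j)) mulr0.
  have [ni|ni] := leqP n (i %% p).
    rewrite a0 // vanish // => j; apply: contraTneq ni => <-.
    by rewrite exponent_mod -ltnNge ltn_pmod.
  have [ig|gi] := ltnP i g; last first.
    rewrite nth_default ?(leq_trans size_a) // vanish // => j.
    apply: contraTneq gi => ji; rewrite -ltnNge in_range // -ji exponent_div.
    by rewrite ltn_divLR.
  have jk : (i %/ p * n + i %% p < k * n)%N.
    move: ig; rewrite in_range // -ltn_divLR // divnMDl //.
    by rewrite (divn_small ni) addn0.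
  have def_i : i = exponent (Ordinal jk).
    rewrite /exponent /= divnMDl // (divn_small ni) addn0.
    by rewrite modnMDl (modn_small ni) -divn_eq.
  by rewrite {2}def_i coef_exponent_sum -def_i.
split.
  apply/leq_sizeP => i gi; rewrite coef_sum big1 // => j _.
  rewrite coefCM coefXn; case: eqP => [ij|_]; last by rewrite mulr0.
  move: gi; rewrite leqNgt ij in_range ?exponent_mod ?ltn_pmod //.
  by rewrite exponent_div ltn_divLR // ltn_ord.
move=> i ni; rewrite coef_sum big1 // => j _.
rewrite coefCM coefXn; case: eqP => [ij|_]; last by rewrite mulr0.
by move: ni; rewrite ij exponent_mod leqNgt ltn_pmod.
Qed.

End Monomials.

(** * The a-number of y^2 = x^m + 1 *)

Section ANumber.

Variables (F : closedFieldType) (p n m g k : nat).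
Hypothesis charF : p \in [pchar F].
Hypothesis def_p : p = n.*2.+1.
Hypothesis n_gt0 : (0 < n)%N.
Hypothesis m1 : (m %% p)%N = 1%N.
Hypothesis g_gt0 : (0 < g)%N.
Hypothesis genus : (g.*2.+1 <= m <= g.*2.+2)%N.
Hypothesis in_range : forall i, (i %% p < n)%N -> (i < g)%N = (i %/ p < k)%N.
Variables (K : fieldExtType {fraction {poly F}}) (y : K).
Hypothesis def_K : is_double_cover ('X^m + 1) y.
Variables (Omega : lmodType K) (d : K -> Omega).
Hypothesis def_Omega : is_Kaehler d.

Let natF_neq0 i : ~~ (p %| i)%N -> i%:R != 0 :> F.
Proof. by rewrite (dvdn_pcharf charF). Qed.

Let two_neq0 : 2%:R != 0 :> F.
Proof. by apply/natF_neq0/negP => /dvdn_leq; rewrite def_p; lia. Qed.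

Let m_neq0 : m%:R != 0 :> F.
Proof. by apply/natF_neq0; rewrite /dvdn m1. Qed.

Let e : {rmorphism {poly F} -> K} := @of_poly F K.

Let chart : is_chart ('X^m + 1) e y.
Proof.
apply: cover_chart => //; first exact: separable_XnD1.
by rewrite size_XnD1 // ltnS lt0n (degree_neq0 m_neq0).
Qed.

Let hY : y ^+ 2 = e ('X^m + 1). Proof. by case: chart. Qed.

Let y0 : y != 0. Proof. exact: ordinate_neq0 chart. Qed.

Let x0 : e 'X != 0.
Proof.
by apply/eqP => /(chart_poly_eq0 chart) /eqP; rewrite polyX_eq0.
Qed.

Let e' : {rmorphism {poly F} -> K} :=
  horner_morph (fun c => mulrC (e 'X)^-1 (cst K c)).

Let e'X : e' 'X = (e 'X)^-1.
Proof. exact: horner_morphX. Qed.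

Let e'C c : e' c%:P = cst K c.
Proof. exact: horner_morphC. Qed.

(** Regularity over the chart (x, y) says that z y is in F[x, y], and regularity
    over the chart at infinity, by integral_at_infinity, that it is a polynomial
    in x of degree below g. *)
Lemma holomorphic_cover z :
  holomorphic d (z *: d (e 'X)) <->
  exists2 a : {poly F}, (size a <= g)%N & z * y = e a.
Proof.
have [der_d _] := def_Omega; case: (der_d) => dD dM dC.
have [dX0 _] := Kaehler_line chart (fun=> erefl) two_neq0 def_Omega.
have xt : e 'X * e' 'X = 1 by rewrite e'X mulfV.
have eC c : e' c%:P = e c%:P by rewrite e'C.
have chart' := infinity_chart m_neq0 genus chart eC xt.
have dT : d (e 'X) = (- (e 'X ^+ 2)) *: d (e' 'X).
  have : d (e 'X * e' 'X) = 0 by rewrite xt -(rmorph1 e) -polyC1 dC.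
  rewrite dM => /(congr1 (fun w => e 'X *: w)).
  rewrite scalerDr scaler0 !scalerA xt scale1r => /eqP.
  by rewrite addrC addr_eq0 -scaleNr expr2 => /eqP.
have dT0 : d (e' 'X) != 0.
  by apply: contra_neq dX0; rewrite dT => ->; rewrite scaler0.
have zT : z *: d (e 'X) = (- (z * e 'X ^+ 2)) *: d (e' 'X).
  by rewrite dT scalerA mulrN.
have swap (u : {poly F} * {poly F}) : z * y = ev e y u ->
    - (z * e 'X ^+ 2) * (y * e' 'X ^+ g.+1) =
    - (e 'X ^+ 2 * ev e y u * e' 'X ^+ g.+1).
  by move=> <-; ring.
have inf u := integral_at_infinity m_neq0 genus u g_gt0 chart eC xt.
split=> [hol|[a size_a za] O placeO].
  have [u hu] :=
    integral_of_holomorphic chart (fun=> erefl) two_neq0 der_d dX0 hol.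
  move: (hol); rewrite zT => hol'.
  have [r hr] := integral_of_holomorphic chart' e'C two_neq0 der_d dT0 hol'.
  have [] : (size u.1 <= g)%N /\ u.2 = 0.
    apply/inf; exists (- r); rewrite -[LHS]opprK -(swap _ hu) hr.
    by rewrite -[- r]sub0r evB /ev !rmorph0 mul0r addr0 sub0r.
  move=> u1 u2; exists u.1 => //.
  by rewrite hu /ev u2 rmorph0 mul0r addr0.
have hu : z * y = ev e y (a, 0) by rewrite ev_poly.
have [_ _ _ /(_ (e 'X)) [xO|tO]] := placeO.
  exact: (regular_of_integral chart (fun=> erefl) der_d placeO xO hu).
have [r hr] : exists r, e 'X ^+ 2 * ev e y (a, 0) * e' 'X ^+ g.+1 =
   ev e' (y * e' 'X ^+ g.+1) r by apply/inf.
rewrite zT.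
apply: (regular_of_integral chart' e'C der_d placeO (u := - r)).
  by rewrite e'X.
rewrite (swap _ hu) hr.
by rewrite -[- r]sub0r evB /ev !rmorph0 mul0r addr0 sub0r.
Qed.

(** Multiply numerator and denominator of a / y by y^(p-1) = f^n: the new
    denominator is a p-th power. *)
Lemma cartier_cover (a : {poly F}) : (size a <= g)%N ->
  cartier d p ((e a / y) *: d (e 'X)) 0 <->
  forall i, (n <= i %% p)%N -> a`_i = 0.
Proof.
move=> size_a.
have [dX0 _] := Kaehler_line chart (fun=> erefl) two_neq0 def_Omega.
have [D [DD DM DC DX]] := derivation_ex chart two_neq0.
have De b : D (e b) = e b^`().
  have := der_poly (M := K^o) DD DM DC b.
  by rewrite DX /GRing.scale /= mulr1.
have e_inj := chart_poly_eq0 chart.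
rewrite -(coef_cartier charF def_p m1); last first.
  by rewrite (leq_trans size_a) //; case/andP: genus => /ltnW; lia.
have yV0 : y^-1 != 0 by rewrite invr_eq0.
rewrite -(cartier_free_poly e_inj charF DD DM De (a * ('X^m + 1) ^+ n) yV0).
have -> : y^-1 ^+ p * e (a * ('X^m + 1) ^+ n) = e a / y.
  rewrite rmorphM rmorphXn -hY -exprM mul2n def_p exprS exprVn.
  by rewrite [e a * _]mulrC -mulrA mulKf ?expf_neq0 // mulrC.
split=> [[h [hw h0]]|[h [hw h0]]]; exists h.
  split.
    apply/eqP; rewrite -subr_eq0; move/eqP: hw.
    by rewrite -subr_eq0 -scalerBl scaler_eq0 (negPf dX0) orbF.
  by apply/eqP; move/eqP: h0; rewrite eq_sym scaler_eq0 (negPf dX0) orbF.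
by rewrite h0 scale0r -hw.
Qed.

Lemma a_number_cover : has_a_number d p (k * n).
Proof.
have n_lt_p : (n < p)%N by rewrite def_p; lia.
have [dX0 line] := Kaehler_line chart (fun=> erefl) two_neq0 def_Omega.
have e_sum (c : 'I_(k * n) -> F) :
    (e (\sum_j (c j)%:P * 'X^(exponent p n j)) / y) *: d (e 'X) =
    \sum_j cst K (c j) *: ((e 'X ^+ exponent p n j / y) *: d (e 'X)).
  rewrite rmorph_sum mulr_suml scaler_suml; apply: eq_bigr => j _.
  by rewrite rmorphM rmorphXn scalerA mulrA.
exists (fun j => (e 'X ^+ exponent p n j / y) *: d (e 'X)); split.
  move=> w; split=> [[]|[c ->]].
    have [z ->] := line w => /holomorphic_cover [a size_a za].
    have -> : z = e a / y by rewrite -za mulfK.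
    move=> /(cartier_cover size_a) a0.
    have [c ->] := (monomial_span n_lt_p n_gt0 in_range a).1 (conj size_a a0).
    by exists c; rewrite e_sum.
  rewrite -e_sum; set a := \sum_j _.
  have [size_a a0] : (size a <= g)%N /\ forall i, (n <= i %% p)%N -> a`_i = 0.
    by apply/(monomial_span n_lt_p n_gt0 in_range); exists c.
  split; last exact/(cartier_cover size_a).
  by apply/holomorphic_cover; exists a; rewrite ?divfK.
move=> c; rewrite -e_sum => /eqP.
rewrite scaler_eq0 (negPf dX0) orbF mulf_eq0 invr_eq0 (negPf y0) orbF.
move=> /eqP /(chart_poly_eq0 chart) c0 i.
by rewrite -(coef_exponent_sum n_lt_p n_gt0 c i) c0 coef0.
Qed.

End ANumber.

Theorem theorem3p1 (F : closedFieldType) (p : nat)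
    (charF : p \in [pchar F]) (p_gt2 : (2 < p)%N)
    (s : nat) (s_ge1 : (1 <= s)%N) (m : nat) (def_m : m = (s * p + 1)%N)
    (K : fieldExtType {fraction {poly F}}) (y : K)
    (def_K : is_double_cover ('X^m + 1) y)
    (Omega : lmodType K) (d : K -> Omega) (def_Omega : is_Kaehler d) :
  (forall k : nat, s = (2 * k + 1)%N ->
     has_a_number d p ((k + 1) * (p - 1) %/ 2)) /\
  (forall k : nat, (1 <= k)%N -> s = (2 * k)%N ->
     has_a_number d p (k * (p - 1) %/ 2)).
Proof.
have pr_p := pcharf_prime charF.
pose n := p./2.
have def_p : p = n.*2.+1.
  have /= := odd_double_half p; case: (even_prime pr_p) => [p2|->] <- //.
  by rewrite p2 in p_gt2.
have n_gt0 : (0 < n)%N by move: p_gt2; rewrite def_p; case: (n).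
have dim j : (j * (p - 1) %/ 2 = j * n)%N.
  by rewrite def_p subn1 /= -muln2 mulnA mulnK.
have m1 : (m %% p = 1)%N by rewrite def_m modnMDl modn_small // ltnW.
split=> [k def_s|k k_gt0 def_s]; rewrite dim.
- have def_m' : m = (k * p + n).*2.+2 by rewrite def_m def_s {2}def_p; lia.
  apply: (a_number_cover (g := k * p + n) charF def_p n_gt0 m1 _ _ _ def_K) => //.
  + by lia.
  + by rewrite def_m'; lia.
  move=> i ip; rewrite {1}(divn_eq i p).
  move: (i %% p)%N ip => r ip.
  by move: (i %/ p)%N => q; rewrite def_p; nia.
- have def_m' : m = (k * p).*2.+1 by rewrite def_m def_s; lia.
  apply: (a_number_cover (g := k * p) charF def_p n_gt0 m1 _ _ _ def_K) => //.
  + by rewrite muln_gt0 k_gt0 prime_gt0.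
  + by rewrite def_m'; lia.
  by move=> i _; rewrite ltn_divLR ?prime_gt0.
Qed.
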